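(* Let $K$ be a field. Then $K$ has only finitely many maximal subrings up to isomorphism if and only if $K\times K$ has only finitely many maximal subrings up to isomorphism.
   Context: All rings are commutative with $1\neq 0$; subrings and homomorphisms are unital. A proper subring $S$ of a ring $R$ is a maximal subring of $R$ if it is maximal with respect to inclusion among the proper subrings of $R$. ''Up to isomorphism'' means that subrings are counted up to ring isomorphism; ''finitely many'' includes the case of none. *)

(* Defs.v *)
From HB Require Import structures.
From mathcomp Require Import all_boot all_order all_algebra.

Set Implicit Arguments.
Unset Strict Implicit.
Unset Printing Implicit Defensive.

Import GRing.Theory.
Local Open Scope ring_scope.

(* Subrings of R are inhabitants of subringClosed R: boolean predicates on R
   containing 1 and closed under subtraction and product.  Under classical
   logic (with choice) these are exactly the unital subrings of R. *)

Definition subring_type (R : comNzRingType) (S : subringClosed R) : Type :=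
  {x : R | x \in S}.

HB.instance Definition _ (R : comNzRingType) (S : subringClosed R) :=
  SubChoice.on (subring_type S).
HB.instance Definition _ (R : comNzRingType) (S : subringClosed R) :=
  [SubChoice_isSubComNzRing of subring_type S by <:].

Definition proper_subring (R : comNzRingType) (S : subringClosed R) : Prop :=
  exists x : R, x \notin S.

Definition maximal_subring (R : comNzRingType) (S : subringClosed R) : Prop :=
  proper_subring S /\
  forall T : subringClosed R,
    proper_subring T -> {subset S <= T} -> T =i S.

Definition ring_isomorphic (A B : comNzRingType) : Prop :=
  exists f : {rmorphism A -> B}, bijective f.

Definition finitely_many_maximal_subrings_up_to_iso (R : comNzRingType) : Prop :=
  exists (n : nat) (F : 'I_n -> subringClosed R),
    (forall i : 'I_n, maximal_subring (F i)) /\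
    (forall S : subringClosed R, maximal_subring S ->
       exists i : 'I_n, ring_isomorphic (subring_type S) (subring_type (F i))).

(* Main.v *)
Require Import Defs.
From HB Require Import structures.
From mathcomp Require Import all_boot all_order all_algebra.
From mathcomp Require Import boolp.

Set Implicit Arguments.
Unset Strict Implicit.
Unset Printing Implicit Defensive.

(** Let M be a maximal subring of K x K.  If M contains the kernel of one of the
    two projections, then M is the preimage of a maximal subring S of K under
    that projection, so M is isomorphic to S x K.  Otherwise M projects onto
    both factors, since the preimage of each projection of M strictly contains
    M; then M meets {0} x K in a proper ideal of K, hence trivially, and the
    first projection is an isomorphism from M to K.  Conversely S x K determines
    S up to isomorphism: an isomorphism from S x K to S' x K either respects the
    two nontrivial idempotents, whence S ~ S', or exchanges them, whence
    S ~ K ~ S'. *)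

Import GRing.Theory.
Local Open Scope ring_scope.

(** * Isomorphisms between product rings and cancellation of a factor *)

Lemma ring_isomorphicI (A B : comNzRingType) (g : A -> B) :
  zmod_morphism g -> monoid_morphism g ->
  injective g -> (forall y, exists x, g x = y) -> ring_isomorphic A B.
Proof.
move=> gB gM g_inj g_surj.
pose h : {rmorphism A -> B} := HB.pack g
  (GRing.isZmodMorphism.Build A B g gB) (GRing.isMonoidMorphism.Build A B g gM).
exists h; have [k kP] := choice g_surj.
by exists k => // x; apply: g_inj; rewrite kP.
Qed.

Lemma ring_isomorphic_sym (A B : comNzRingType) :
  ring_isomorphic A B -> ring_isomorphic B A.
Proof.
case=> f [g fK gK]; apply: (@ring_isomorphicI _ _ g).
- by move=> x y; rewrite -[in LHS](gK x) -[in LHS](gK y) -rmorphB fK.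
- split; first by rewrite -(rmorph1 f) fK.
  by move=> x y; rewrite -[in LHS](gK x) -[in LHS](gK y) -rmorphM fK.
- exact: can_inj gK.
- by move=> x; exists (f x).
Qed.

Lemma ring_isomorphic_trans (B A C : comNzRingType) :
  ring_isomorphic A B -> ring_isomorphic B C -> ring_isomorphic A C.
Proof.
by case=> f f_bij [g g_bij]; exists (g \o f : {rmorphism A -> C});
   apply: bij_comp.
Qed.

Lemma prod_swap_rmorphism (A B : comNzRingType) :
  exists2 g : {rmorphism A * B -> B * A}, bijective g
    & forall p, g p = (p.2, p.1).
Proof.
pose g0 (p : A * B) := (p.2, p.1).
have gB : zmod_morphism g0 by [].
have gM : monoid_morphism g0 by [].
pose g : {rmorphism A * B -> B * A} := HB.pack g0
  (GRing.isZmodMorphism.Build _ _ g0 gB)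
  (GRing.isMonoidMorphism.Build _ _ g0 gM).
by exists g => //; exists (fun p => (p.2, p.1)) => -[].
Qed.

Lemma ring_isomorphic_prodl (A B C : comNzRingType) :
  ring_isomorphic A B -> ring_isomorphic (A * C)%type (B * C)%type.
Proof.
case=> f f_bij; apply: (@ring_isomorphicI _ _ (fun p => (f p.1, p.2))).
- by move=> p q; rewrite /= rmorphB.
- by split=> [|p q]; rewrite /= ?rmorph1 ?rmorphM.
- by move=> [a b] [c d] [/(bij_inj f_bij) -> ->].
- by case: f_bij => g _ gK [b c]; exists (g b, c); rewrite /= gK.
Qed.

(** The ideal generated by the idempotent [(1, 0)] is a copy of the first factor. As [f] matches
    these idempotents, it carries one ideal onto the other. *)
Lemma ring_isomorphic_fst (A B C D : comNzRingType)
    (f : {rmorphism A * C -> B * D}) :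
  bijective f -> f (1, 0) = (1, 0) -> ring_isomorphic A B.
Proof.
move=> f_bij fe.
(* Multiplying by [(1, 0)] erases the second coordinate on both sides of [f]. The freedom in [y] is
   what gives surjectivity below. *)
have f0 x y : f (x, 0) = ((f (x, y)).1, 0).
  have -> : (x, 0) = (x, y) * (1, 0) :> A * C.
    by congr pair; rewrite /= ?mulr1 ?mulr0.
  by rewrite rmorphM fe; congr pair; rewrite /= ?mulr1 ?mulr0.
apply: (@ring_isomorphicI _ _ (fun x => (f (x, 0)).1)).
- move=> x y.
  have -> : (x - y, 0) = (x, 0) - (y, 0) :> A * C by congr pair; rewrite /= subr0.
  by rewrite rmorphB.
- split=> [|x y]; first by rewrite fe.
  have -> : (x * y, 0) = (x, 0) * (y, 0) :> A * C by congr pair; rewrite /= mulr0.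
  by rewrite rmorphM.
- move=> x y exy; have : f (x, 0) = f (y, 0) by rewrite (f0 x 0) (f0 y 0) exy.
  by move/(bij_inj f_bij) => [].
- case: f_bij => g _ gK b; exists (g (b, 0)).1.
  by rewrite (f0 _ (g (b, 0)).2) -surjective_pairing gK.
Qed.

Definition connected_ring (A : comNzRingType) : Prop :=
  forall u : A, u * u = u -> u = 0 \/ u = 1.

Lemma ring_isomorphic_prod_cancel (A B C : comNzRingType) :
  connected_ring B -> connected_ring C ->
  ring_isomorphic (A * C)%type (B * C)%type -> ring_isomorphic A B.
Proof.
move=> cB cC [f f_bij].
have f_inj := bij_inj f_bij.
have idem : f (1, 0) * f (1, 0) = f (1, 0).
  by rewrite -rmorphM; congr (f _); congr pair; rewrite /= ?mulr1 ?mulr0.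
have f01 : f (0, 1) = 1 - f (1, 0).
  rewrite -(rmorph1 f) -rmorphB; congr (f _).
  by congr pair; rewrite /= ?subrr ?subr0.
case fe: (f (1, 0)) idem f01 => [u v] [/cB u01 /cC v01] f01.
have fe0 : (u, v) <> 0.
  by rewrite -fe -(rmorph0 f) => /f_inj [] /eqP; rewrite oner_eq0.
have fe1 : (u, v) <> 1.
  by rewrite -fe -(rmorph1 f) => /f_inj [] /esym /eqP; rewrite oner_eq0.
(* Of the four candidates for [f (1, 0)], the values 0 and 1 are excluded by injectivity; [(1, 0)]
   is treated first, then [(0, 1)]. *)
case: u01 v01 fe f01 fe0 fe1 => -> [] -> fe f01 fe0 fe1 //; last first.
  exact: ring_isomorphic_fst f_bij fe.
(* Here [f] exchanges the idempotents. A swap after [f] gives [A] ~ [C], and a swap before [f] gives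
   [C] ~ [B]. *)
have [g g_bij gE] := prod_swap_rmorphism B C.
have [h h_bij hE] := prod_swap_rmorphism C A.
have AC : ring_isomorphic A C.
  apply: (@ring_isomorphic_fst _ _ _ _ (g \o f : {rmorphism _ -> _})).
    exact: bij_comp.
  by rewrite /= fe gE.
have CB : ring_isomorphic C B.
  apply: (@ring_isomorphic_fst _ _ _ _ (f \o h : {rmorphism _ -> _})).
    exact: bij_comp.
  by rewrite /= hE f01; congr pair; rewrite /= ?subr0 ?subrr.
exact: ring_isomorphic_trans AC CB.
Qed.

Lemma connected_field (K : fieldType) : connected_ring K.
Proof.
move=> u /eqP; rewrite -subr_eq0 -[X in _ - X]mulr1 -mulrBr mulf_eq0 subr_eq0.
by case/orP=> /eqP ->; [left | right].
Qed.

Lemma connected_subring (A : comNzRingType) (S : subringClosed A) :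
  connected_ring A -> connected_ring (subring_type S).
Proof.
by move=> cA u /(congr1 val); rewrite rmorphM => /cA [] u01; [left | right];
   apply: val_inj; rewrite u01 ?rmorph0 ?rmorph1.
Qed.

(** * Images and preimages of subrings *)

Lemma ring_isomorphic_subring (A B : comNzRingType) (T : subringClosed B)
    (g : {rmorphism A -> B}) :
  injective g -> (forall x, g x \in T) ->
  (forall y, y \in T -> exists x, g x = y) ->
  ring_isomorphic A (subring_type T).
Proof.
move=> g_inj gin g_surj.
apply: (@ring_isomorphicI _ _ (fun x => Sub (g x) (gin x) : subring_type T)).
- by move=> x y; apply: val_inj; exact: (rmorphB g x y).
- split=> [|x y]; apply: val_inj; first exact: (rmorph1 g).
  exact: (rmorphM g x y).
- by move=> x y /(congr1 val); exact: g_inj.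
- by move=> y; have [x xy] := g_surj _ (valP y); exists x; apply: val_inj.
Qed.

Lemma subring_of (R : comNzRingType) (P : {pred R}) :
  subring_closed P -> exists S : subringClosed R, S =i P.
Proof.
move=> PS.
pose S : subringClosed R := HB.pack P (GRing.isSubringClosed.Build R P PS).
by exists S.
Qed.

Lemma subring_preim (A B : comNzRingType) (f : {rmorphism A -> B})
    (S : subringClosed B) :
  exists M : subringClosed A, forall x, (x \in M) = (f x \in S).
Proof.
have [|M ME] := @subring_of A [pred x | f x \in S].
  split=> [|x y|x y]; rewrite !inE ?rmorph1 ?rpred1 // => xS yS.
    by rewrite rmorphB rpredB.
  by rewrite rmorphM rpredM.
by exists M => x; rewrite ME inE.
Qed.

Lemma subring_image (A B : comNzRingType) (f : {rmorphism A -> B})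
    (M : subringClosed A) :
  exists S : subringClosed B,
    forall y, (y \in S) <-> exists2 x, x \in M & f x = y.
Proof.
have [|S SE] := @subring_of B [pred y | `[< exists2 x, x \in M & f x = y >]].
  split=> [|_ _ /asboolP [x xM <-] /asboolP [y yM <-]
            |_ _ /asboolP [x xM <-] /asboolP [y yM <-]]; apply/asboolP.
  - by exists 1; rewrite ?rpred1 ?rmorph1.
  - by exists (x - y); rewrite ?rpredB ?rmorphB.
  - by exists (x * y); rewrite ?rpredM ?rmorphM.
by exists S => y; rewrite SE; split=> /asboolP.
Qed.

(** The image of [M] serves as [S]: if [f x = f y] with [y] in [M], then [x - y] lies in the kernel,
    hence in [M], and so does [x]. *)
Lemma subring_of_ker (A B : comNzRingType) (f : {rmorphism A -> B})
    (M : subringClosed A) :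
  (forall x, f x = 0 -> x \in M) ->
  exists S : subringClosed B, forall x, (x \in M) = (f x \in S).
Proof.
move=> kerM; have [S SP] := subring_image f M; exists S => x.
apply/idP/idP => [xM|/SP [y yM fyx]]; first by apply/SP; exists x.
rewrite -(subrK y x) rpredD // kerM //.
by rewrite rmorphB fyx subrr.
Qed.

(** This is the correspondence theorem: taking preimages matches the subrings above [S] with those
    above [M], and surjectivity of [f] preserves properness. *)
Lemma maximal_subring_preim (A B : comNzRingType) (f : {rmorphism A -> B})
    (M : subringClosed A) (S : subringClosed B) :
  (forall y, exists x, f x = y) -> (forall x, (x \in M) = (f x \in S)) ->
  maximal_subring M <-> maximal_subring S.
Proof.
move=> f_surj MS; split=> -[[z zN] maxN]; split.
- by exists (f z); rewrite -MS.
- move=> T [y yT] ST; have [N NT] := subring_preim f T.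
  have NM : N =i M.
    apply: maxN => [|x]; last by rewrite MS NT => /ST.
    by have [x fx] := f_surj y; exists x; rewrite NT fx.
  by move=> u; have [x <-] := f_surj u; rewrite -NT NM.
- by have [x fx] := f_surj z; exists x; rewrite MS fx.
- move=> N [x xN] MN.
  (* [M] contains the kernel because 0 is in [S]; hence so does [N], which is therefore a
     preimage. *)
  have [u fu0|T NT] := @subring_of_ker A B f N.
    by rewrite MN // MS fu0 rpred0.
  have TS : T =i S.
    apply: maxN => [|y yS]; first by exists (f x); rewrite -NT.
    by have [u fu] := f_surj y; rewrite -fu -NT MN // MS fu.
  by move=> u; rewrite NT TS MS.
Qed.

(** * Maximal subrings of a product and their isomorphism types *)

Lemma fst_surjective (A B : comNzRingType) (x : A) : exists p : A * B, p.1 = x.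
Proof. by exists (x, 0). Qed.

Lemma snd_surjective (A B : comNzRingType) (y : B) : exists p : A * B, p.2 = y.
Proof. by exists (0, y). Qed.

Lemma fst_preim_isomorphic (A B : comNzRingType) (S : subringClosed A)
    (M : subringClosed (A * B)%type) :
  (forall p, (p \in M) = (p.1 \in S)) ->
  ring_isomorphic (subring_type M) (subring_type S * B)%type.
Proof.
move=> MS; apply: ring_isomorphic_sym.
pose g0 (p : subring_type S * B) := (val p.1, p.2).
have gB : zmod_morphism g0 by [].
have gM : monoid_morphism g0 by [].
pose g : {rmorphism subring_type S * B -> A * B} := HB.pack g0
  (GRing.isZmodMorphism.Build _ _ g0 gB)
  (GRing.isMonoidMorphism.Build _ _ g0 gM).
apply: (@ring_isomorphic_subring _ _ _ g).
- by move=> [a b] [c d] [/val_inj -> ->].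
- by move=> [a b]; rewrite MS; apply: valP.
- by move=> [a b]; rewrite MS => aS; exists (Sub a aS, b).
Qed.

Lemma snd_preim_isomorphic (A B : comNzRingType) (S : subringClosed B)
    (M : subringClosed (A * B)%type) :
  (forall p, (p \in M) = (p.2 \in S)) ->
  ring_isomorphic (subring_type M) (subring_type S * A)%type.
Proof.
move=> MS; have [h h_bij hE] := prod_swap_rmorphism B A.
have [N NM] := subring_preim h M.
apply: (@ring_isomorphic_trans (subring_type N)); last first.
  by apply: fst_preim_isomorphic => p; rewrite NM MS hE.
apply: ring_isomorphic_sym.
apply: (@ring_isomorphic_subring _ _ _ (h \o val : {rmorphism _ -> _})).
- by apply: inj_comp val_inj; apply: bij_inj.
- by move=> x; rewrite -NM; apply: valP.
- case: h_bij => k _ hK y yM.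
  have kyN : k y \in N by rewrite NM hK.
  by exists (Sub (k y) kyN); rewrite /= hK.
Qed.

(** The preimage of the image of [M] contains [M] and also [z], so by maximality it is the whole
    ring. *)
Lemma maximal_subring_image (A B : comNzRingType) (f : {rmorphism A -> B})
    (M : subringClosed A) (z : A) :
  (forall y, exists x, f x = y) -> maximal_subring M ->
  f z = 0 -> z \notin M -> forall y, exists2 x, x \in M & f x = y.
Proof.
move=> f_surj [_ maxM] fz zM y; have [S SP] := subring_image f M.
have [N NS] := subring_preim f S.
apply/SP/negPn/negP => yS.
have NM : N =i M; last by case/negP: zM; rewrite -NM NS fz rpred0.
apply: maxM => [|x xM]; last by rewrite NS; apply/SP; exists x.
by have [x fx] := f_surj y; exists x; rewrite NS fx.
Qed.

Lemma maximal_subring_prod (K : fieldType) (M : subringClosed (K * K)%type) :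
  maximal_subring M ->
  ring_isomorphic (subring_type M) K \/
  exists2 S : subringClosed K, maximal_subring S &
    ring_isomorphic (subring_type M) (subring_type S * K)%type.
Proof.
move=> maxM.
have [ker1|] := pselect (forall p : K * K, p.1 = 0 -> p \in M).
  have [S MS] := @subring_of_ker _ _ (fst : {rmorphism K * K -> K}) M ker1.
  right; exists S; last exact: fst_preim_isomorphic.
  exact: (proj1 (maximal_subring_preim (@fst_surjective K K) MS) maxM).
move=> /existsNP [[z y0] /not_implyP [/= -> /negP y0M]] {z}.
have [ker2|] := pselect (forall p : K * K, p.2 = 0 -> p \in M).
  have [S MS] := @subring_of_ker _ _ (snd : {rmorphism K * K -> K}) M ker2.
  right; exists S; last exact: snd_preim_isomorphic.
  exact: (proj1 (maximal_subring_preim (@snd_surjective K K) MS) maxM).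
move=> /existsNP [[x0 z] /not_implyP [/= -> /negP x0M]] {z}.
left.
have M1 := maximal_subring_image (f := fst) (@fst_surjective K K) maxM
  (erefl : (0, y0).1 = 0) y0M.
have M2 := maximal_subring_image (f := snd) (@snd_surjective K K) maxM
  (erefl : (x0, 0).2 = 0) x0M.
(* If [b] were nonzero, an element of [M] with second coordinate [b^-1 * y0] times [(0, b)] would
   put [(0, y0)] in [M]. *)
have M0 b : (0, b) \in M -> b = 0.
  move=> bM; apply: contraNeq y0M => b0.
  have [[x c] xcM /= cE] := M2 (b^-1 * y0).
  have -> : (0, y0) = (0, b) * (x, c).
    by congr pair; rewrite /= ?mul0r // cE mulVKf.
  exact: rpredM.
apply: (@ring_isomorphicI _ _ (fun p => (val p).1)).
- by [].
- by [].
(* Elements of [M] with equal first coordinates differ by some [(0, b - d)] in [M], which [M0] makes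
   zero. *)
- move=> p q pq; apply: val_inj; apply/eqP; rewrite -subr_eq0.
  have : val p - val q \in M by apply: rpredB; apply: valP.
  move: pq; case: (val p) (val q) => [a b] [c d] /= ->.
  have -> : (c, b) - (c, d) = (0, b - d) by congr pair; rewrite /= subrr.
  by move/M0 => ->.
- by move=> x; have [p pM px] := M1 x; exists (Sub p pM).
Qed.

(** [Q] labels subrings by a finite type so that a label determines the isomorphism class. Only the
    labels carried by some maximal subring are kept, and choice picks a representative for each. *)
Lemma finitely_many_maximal_subringsI (R : comNzRingType) (I : finType)
    (Q : I -> subringClosed R -> Prop) :
  (forall S, maximal_subring S -> exists i, Q i S) ->
  (forall i S T, Q i S -> Q i T ->
     ring_isomorphic (subring_type S) (subring_type T)) ->
  finitely_many_maximal_subrings_up_to_iso R.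
Proof.
move=> Qmax Qiso.
pose J := [pred i | `[< exists S, maximal_subring S /\ Q i S >]].
have JP (k : 'I_#|J|) : exists S, maximal_subring S /\ Q (enum_val k) S.
  exact/asboolP/(enum_valP k).
have [F FP] := choice JP.
exists #|J|, F; split=> [k|S maxS]; first by have [] := FP k.
have [i iS] := Qmax S maxS.
have iJ : i \in J by rewrite inE; apply/asboolP; exists S.
exists (enum_rank_in iJ i); apply: Qiso iS _.
by have [_] := FP (enum_rank_in iJ i); rewrite enum_rankK_in.
Qed.

Theorem proposition3p15 (K : fieldType) :
  finitely_many_maximal_subrings_up_to_iso K <->
  finitely_many_maximal_subrings_up_to_iso (K * K)%type.
Proof.
split=> -[n [F [_ FP]]].
(* The label [None] stands for the class of [K] itself, [Some i] for that of [F i] times [K]. *)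
- apply: (@finitely_many_maximal_subringsI _ (option 'I_n) (fun o M =>
    if o is Some i
    then ring_isomorphic (subring_type M) (subring_type (F i) * K)%type
    else ring_isomorphic (subring_type M) K)) => [M|[i|] M N MF NF].
  + case/maximal_subring_prod => [MK|[S /FP [i Si] MS]]; first by exists None.
    by exists (Some i);
       apply: ring_isomorphic_trans MS (ring_isomorphic_prodl _ Si).
  + exact: ring_isomorphic_trans MF (ring_isomorphic_sym NF).
  + exact: ring_isomorphic_trans MF (ring_isomorphic_sym NF).
(* A maximal [S] is labelled by the class of its preimage under [fst], a maximal subring isomorphic
   to [S] times [K]; cancelling [K] recovers [S]. *)
- apply: (@finitely_many_maximal_subringsI _ 'I_n (fun i S =>
    ring_isomorphic (subring_type S * K)%type (subring_type (F i))))
    => [S maxS|i S T SF TF].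
  + have [M MS] := subring_preim (fst : {rmorphism K * K -> K}) S.
    have /FP [i Mi] : maximal_subring M.
      exact: (proj2 (maximal_subring_preim (@fst_surjective K K) MS) maxS).
    exists i; apply: ring_isomorphic_trans Mi.
    exact/ring_isomorphic_sym/fst_preim_isomorphic.
  + apply: (@ring_isomorphic_prod_cancel _ _ K).
    * exact/connected_subring/connected_field.
    * exact: connected_field.
    * exact: ring_isomorphic_trans SF (ring_isomorphic_sym TF).
Qed.
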